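(* In the edge-distinguishing game (EDGe) played on the path $P_4$ (with $\lambda(P_4)$ colors), Player 1 has a winning strategy.
   Context: $P_n$ is the path on $n$ vertices. For a positive integer $k$ let $[k]=\{1,\dots,k\}$. A $k$-coloring $c:V(G)\to[k]$ induces $c'(\{u,v\})=\{c(u),c(v)\}$ (a multiset); $c$ is edge-distinguishing if $c'$ is injective, and $\lambda(G)$ is the least $k$ admitting such a coloring. A partial coloring on $U\subseteq V(G)$ has partial induced edge coloring on $G[U]$. EDGe on $G$: two players, Player 1 first, alternately color an uncolored vertex with a color from $[\lambda(G)]$; a move is legal iff afterwards the partial induced edge coloring of the colored vertices is injective. The player making the last legal move wins. A winning strategy guarantees a win regardless of the opponent's play. *)

(* Defs.v *)
From mathcomp Require Import all_boot.
From mathcomp Require Import finmap multiset.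

Set Implicit Arguments.
Unset Strict Implicit.
Unset Printing Implicit Defensive.

Local Open Scope mset_scope.
Local Open Scope nat_scope.

Record sgraph := SGraph {
  vertex :> finType;
  adj : rel vertex;
  adj_sym : symmetric adj;
  adj_irrefl : irreflexive adj
}.

Definition path_adj (n : nat) : rel 'I_n :=
  fun i j => (i.+1 == j :> nat) || (j.+1 == i :> nat).

Lemma path_adj_sym n : symmetric (@path_adj n).
Proof. by move=> i j; rewrite /path_adj orbC. Qed.

Lemma path_adj_irrefl n : irreflexive (@path_adj n).
Proof. by move=> i; rewrite /path_adj orbb; apply/negbTE; rewrite gtn_eqF. Qed.

Definition path_graph (n : nat) : sgraph :=
  SGraph (@path_adj_sym n) (@path_adj_irrefl n).

Definition edges (G : sgraph) : {set {set G}} :=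
  [set [set p.1; p.2] | p : G * G & adj p.1 p.2].

(* The color set [k] is represented by 'I_k. *)

Definition induced_edge_coloring (G : sgraph) (k : nat)
    (c : {ffun G -> 'I_k}) (E : {set G}) : {mset 'I_k} :=
  seq_mset [seq c v | v <- enum E].

Definition edge_distinguishing (G : sgraph) (k : nat)
    (c : {ffun G -> 'I_k}) : bool :=
  dinjectiveb (induced_edge_coloring c) (edges G).

Definition has_edge_distinguishing (G : sgraph) (k : nat) : bool :=
  (0 < k) && [exists c : {ffun G -> 'I_k}, edge_distinguishing c].

(* Giving all vertices different colors is always edge-distinguishing. *)
Lemma ex_edge_distinguishing (G : sgraph) : exists k, has_edge_distinguishing G k.
Proof.
exists #|G|.+1; rewrite /has_edge_distinguishing /=; apply/existsP.
pose f (v : G) : 'I_#|G|.+1 := widen_ord (leqnSn _) (enum_rank v).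
have f_inj : injective f.
  by move=> u v /(congr1 val) /= /val_inj /enum_rank_inj.
exists (finfun f); apply/dinjectiveP => A B _ _ /eq_seq_msetP AB.
have memE (E : {set G}) v :
    (f v \in [seq finfun f u | u <- enum E]) = (v \in E).
  by rewrite (eq_map (ffunE f)) mem_map // mem_enum.
by apply/setP => v; rewrite -!memE (perm_mem AB).
Qed.

Definition lambda (G : sgraph) : nat := ex_minn (ex_edge_distinguishing G).

(* A partial coloring is defined on U = colored c; None marks an uncolored
   vertex. *)
Definition partial_coloring (G : sgraph) (k : nat) := {ffun G -> option 'I_k}.

Definition colored (G : sgraph) (k : nat) (c : partial_coloring G k) : {set G} :=
  [set v | c v != None].

Definition induced_edges (G : sgraph) (U : {set G}) : {set {set G}} :=
  [set E in edges G | E \subset U].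

Definition partial_induced_edge_coloring (G : sgraph) (k : nat)
    (c : partial_coloring G k) (E : {set G}) : {mset 'I_k} :=
  seq_mset (pmap c (enum E)).

Definition partial_edge_distinguishing (G : sgraph) (k : nat)
    (c : partial_coloring G k) : bool :=
  dinjectiveb (partial_induced_edge_coloring c) (induced_edges (colored c)).

Definition move (G : sgraph) (k : nat) : Type := (G * 'I_k)%type.

Definition uncolored (G : sgraph) (k : nat) : partial_coloring G k :=
  [ffun => None].

Definition make_move (G : sgraph) (k : nat) (c : partial_coloring G k)
    (m : move G k) : partial_coloring G k :=
  [ffun v => if v == m.1 then Some m.2 else c v].

Definition legal (G : sgraph) (k : nat) (c : partial_coloring G k)
    (m : move G k) : bool :=
  (c m.1 == None) && partial_edge_distinguishing (make_move c m).

(* A history is the sequence of moves made so far, earliest first. *)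
Definition position (G : sgraph) (k : nat) (h : seq (move G k)) :
    partial_coloring G k :=
  foldl (@make_move G k) (uncolored G k) h.

Definition legal_history (G : sgraph) (k : nat) (h : seq (move G k)) : Prop :=
  forall h1 m h2, h = h1 ++ m :: h2 -> legal (position h1) m.

Definition game_over (G : sgraph) (k : nat) (h : seq (move G k)) : Prop :=
  forall m, ~~ legal (position h) m.

Inductive player := Player1 | Player2.

(* The player making the move preceded by i earlier moves. *)
Definition mover (i : nat) : player := if odd i then Player2 else Player1.

Definition made_last_move (G : sgraph) (k : nat) (p : player)
    (h : seq (move G k)) : Prop :=
  exists h' m, h = rcons h' m /\ mover (size h') = p.

Definition strategy (G : sgraph) (k : nat) := seq (move G k) -> move G k.

Definition follows (G : sgraph) (k : nat) (p : player) (s : strategy G k)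
    (h : seq (move G k)) : Prop :=
  forall h1 m h2, h = h1 ++ m :: h2 -> mover (size h1) = p -> m = s h1.

(* The first clause is needed because strategies are total functions: when it is
   p's turn and a legal move exists, the strategy must actually give one. *)
Definition winning_strategy (G : sgraph) (k : nat) (p : player)
    (s : strategy G k) : Prop :=
  forall h, legal_history h -> follows p s h ->
    (mover (size h) = p -> ~ game_over h -> legal (position h) (s h)) /\
    (game_over h -> made_last_move p h).

Definition EDGe_has_winning_strategy (G : sgraph) (p : player) : Prop :=
  exists s : strategy G (lambda G), winning_strategy p s.

(* Main.v *)
Require Import Defs.
From mathcomp Require Import all_boot.
From mathcomp Require Import finmap multiset.
From mathcomp Require Import zify.

Set Implicit Arguments.
Unset Strict Implicit.
Unset Printing Implicit Defensive.

(** Here [lambda P_4 = 2], and the only edge-distinguishing 2-colorings of the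
    path [v0 v1 v2 v3] are [aabb]: the three edges must use all three multisets
    of colors, and the two monochromatic ones cannot be adjacent.  So [v1] and
    [v3] get different colors, [v2] and [v3] the same one.  Player 1 colors [v0]
    first; whichever vertex Player 2 takes, Player 1 can legally color another
    one so as to violate one of these two conditions.  The coloring can then
    not be completed, so that the game ends after exactly three moves. *)

Lemma edgesP (G : sgraph) (E : {set G}) :
  reflect (exists u v : G, adj u v /\ E = [set u; v]) (E \in edges G).
Proof.
apply: (iffP imsetP) => [[[u v] /= + ->]|[u [v [uv ->]]]].
  by rewrite inE => uv; exists u, v.
by exists (u, v); rewrite ?inE.
Qed.

Lemma path_edgesP n (E : {set 'I_n}) :
  reflect (exists i j : 'I_n, i.+1 = j /\ E = [set i; j])
          (E \in edges (path_graph n)).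
Proof.
apply: (iffP (@edgesP (path_graph n) E)) => [[u [v [uv ->]]]|[i [j [ij ->]]]].
  case/orP: uv => /eqP uv; first by exists u, v.
  by exists v, u; rewrite setUC.
by exists i, j; split=> //; rewrite /= /path_adj ij eqxx.
Qed.

Lemma perm_enum_set2 (T : finType) (u v : T) :
  u != v -> perm_eq (enum [set u; v]) [:: u; v].
Proof.
move=> uv; apply: uniq_perm; rewrite ?enum_uniq //= ?inE ?uv //.
by move=> x; rewrite mem_enum !inE.
Qed.

Lemma partial_induced_edge_coloring_set2 (G : sgraph) k
    (c : partial_coloring G k) (u v : G) : u != v ->
  partial_induced_edge_coloring c [set u; v] = seq_mset (pmap c [:: u; v]).
Proof.
by move=> uv; apply/eq_seq_msetP/perm_pmap/perm_enum_set2.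
Qed.

(** Treats a full coloring as a partial one, so that the criterion used for legality also serves to
    compute [lambda]. *)
Lemma partial_edge_distinguishing_total (G : sgraph) k (c : {ffun G -> 'I_k}) :
  partial_edge_distinguishing ([ffun v => Some (c v)] : partial_coloring G k)
  = edge_distinguishing c.
Proof.
set p : partial_coloring G k := [ffun v => _].
have pE E : partial_induced_edge_coloring p E = induced_edge_coloring c E.
  rewrite /partial_induced_edge_coloring /induced_edge_coloring; congr seq_mset.
  by elim: (enum E) => //= v s ->; rewrite ffunE.
have edgesE : induced_edges (colored p) =i edges G.
  move=> E; rewrite !inE; case: (E \in edges G) => //=.
  by apply/subsetP => v _; rewrite inE ffunE.
by apply/dinjectiveP/dinjectiveP => inj E F EG FG EF;
  apply: inj; rewrite ?edgesE ?pE // -?edgesE // -!pE.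
Qed.

(** Equality of the color multisets of two colored edges, as a Boolean on options that computes. The
    disjunction passes the [None] tests on to [a'] and [b']. *)
Definition same_edge_color k (a b a' b' : option 'I_k) : bool :=
  [&& a != None, b != None & ((a, b) == (a', b')) || ((a, b) == (b', a'))].

(** An edge of a path is determined by its lower endpoint, so equality of edges becomes [i = j]. *)
Lemma path_partial_edge_distinguishingP n k
    (c : partial_coloring (path_graph n) k) :
  reflect (forall i i' j j' : 'I_n, i.+1 = i' -> j.+1 = j' ->
             same_edge_color (c i) (c i') (c j) (c j') -> i = j)
          (partial_edge_distinguishing c).
Proof.
have neqS (i i' : 'I_n) : i.+1 = i' -> i != i' :> path_graph n.
  by move=> ii'; rewrite -val_eqE /= -ii' ltn_eqF.
apply: (iffP (@dinjectiveP _ _ _ _)) => [inj i i' j j' ii' jj' | inj E F].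
  case/and3P => ci ci' cc.
  have [cj cj'] : c j != None /\ c j' != None.
    by case/orP: cc => /eqP[] <- <-.
  have: [set i; i'] = [set j; j'].
    apply: inj.
    - rewrite inE; apply/andP; split; first by apply/path_edgesP; exists i, i'.
      by apply/subsetP => x; rewrite !inE => /orP[] /eqP ->.
    - rewrite inE; apply/andP; split; first by apply/path_edgesP; exists j, j'.
      by apply/subsetP => x; rewrite !inE => /orP[] /eqP ->.
    rewrite !partial_induced_edge_coloring_set2 ?neqS //; apply/eq_seq_msetP.
    rewrite /=; case/orP: cc => /eqP[] -> -> //.
    by case: (c j) (c j') => [x|] [y|] //=; rewrite -cat1s perm_catC.
  move=> ij; apply/val_inj => /=.
  have: i \in [set j; j'] by rewrite -ij !inE eqxx.
  have: i' \in [set j; j'] by rewrite -ij !inE eqxx orbT.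
  (* The crossed matching would need both [i = j.+1] and [i.+1 = j], which is absurd. *)
  by rewrite !inE -!val_eqE /= -ii' -jj' => /orP[] /eqP ? /orP[] /eqP ? //; lia.
rewrite !inE => /andP[/path_edgesP[i [i' [ii' ->]]] /subsetP Ei].
move=> /andP[/path_edgesP[j [j' [jj' ->]]] /subsetP Ej].
rewrite !partial_induced_edge_coloring_set2 ?neqS // => /eq_seq_msetP /= cc.
have: i = j.
  apply: (inj i i' j j') => //.
  have := Ei i; rewrite !inE eqxx => /(_ isT); move: cc.
  have := Ei i'; rewrite !inE eqxx orbT => /(_ isT).
  have := Ej j; rewrite !inE eqxx => /(_ isT).
  have := Ej j'; rewrite !inE eqxx orbT => /(_ isT).
  rewrite /same_edge_color.
  case: (c i) (c i') (c j) (c j') => [x|] [y|] [z|] [t|] //= _ _ _ cc _.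
  (* The color [x] is [z] or [t]; cancelling it leaves singletons, which gives the straight or the
     crossed match. *)
  have := perm_mem cc x; rewrite !inE eqxx /= => /esym /orP[] /eqP xE; subst x.
    by move: cc; rewrite perm_cons => /perm_mem/(_ y);
       rewrite !inE eqxx => /esym/eqP ->; rewrite eqxx.
  move: cc; rewrite -[[:: z; t]]/([:: z] ++ [:: t]) perm_sym perm_catC perm_sym.
  by rewrite perm_cons => /perm_mem/(_ y);
     rewrite !inE eqxx => /esym/eqP ->; rewrite eqxx orbT.
move=> ij; congr [set _; _] => //.
by apply: val_inj; rewrite /= -ii' -jj' ij.
Qed.

(* Ordinals with closed proofs, unlike [inord], make legality computable. *)
Notation "''v_' i" := (@Ordinal 4 i isT : path_graph 4) (at level 8, i at level 2).

(** One test per pair of distinct edges. The argument is a plain function, so that [color_after h]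
    can be supplied and evaluated. *)
Definition path4_distinguishing k (c : path_graph 4 -> option 'I_k) : bool :=
  [&& ~~ same_edge_color (c 'v_0) (c 'v_1) (c 'v_1) (c 'v_2),
      ~~ same_edge_color (c 'v_0) (c 'v_1) (c 'v_2) (c 'v_3) &
      ~~ same_edge_color (c 'v_1) (c 'v_2) (c 'v_2) (c 'v_3)].

Lemma path4_partial_edge_distinguishingE k
    (c : partial_coloring (path_graph 4) k) :
  partial_edge_distinguishing c = path4_distinguishing c.
Proof.
apply/path_partial_edge_distinguishingP/and3P => [inj|[n1 n2 n3]].
  by split; apply/negP => /inj => /(_ erefl erefl).
(* The criterion lists each pair of edges in one order only. *)
have sym a b a' b' : same_edge_color a b a' b' -> @same_edge_color k a' b' a b.
  by case/and3P => a0 b0 /orP[] /eqP[ea eb]; move: a0 b0; rewrite ea eb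
    /same_edge_color => -> ->; rewrite eqxx ?orbT.
have vE (x : 'I_4) : x = nth ord0 [:: 'v_0; 'v_1; 'v_2; 'v_3] x.
  by apply: val_inj; case: x => [[|[|[|[|?]]]] ?].
move=> i i' j j' ii' jj'.
rewrite (vE i) (vE i') (vE j) (vE j') -ii' -jj'.
have: i < 3 by have := ltn_ord i'; rewrite -ii'.
have: j < 3 by have := ltn_ord j'; rewrite -jj'.
move: (nat_of_ord i) (nat_of_ord j) => [|[|[|?]]] [|[|[|?]]] //= _ _ //;
  by [move=> cc; rewrite cc in n1 n2 n3 | move=> /sym cc; rewrite cc in n1 n2 n3].
Qed.

(** Tracks a single vertex through the history without building finite functions, so that it
    evaluates on explicit histories. *)
Definition color_after (G : sgraph) k (h : seq (move G k)) (v : G) :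
    option 'I_k :=
  foldl (fun a m => if v == m.1 then Some m.2 else a) None h.

Lemma positionE (G : sgraph) k (h : seq (move G k)) (v : G) :
  position h v = color_after h v.
Proof.
elim/last_ind: h => [|h m IHh]; first by rewrite ffunE.
by rewrite /position /color_after !foldl_rcons ffunE -/(position h) IHh.
Qed.

Lemma path4_legalE k (h : seq (move (path_graph 4) k)) m :
  legal (position h) m =
  (color_after h m.1 == None) && path4_distinguishing (color_after (rcons h m)).
Proof.
rewrite /legal positionE -foldl_rcons -/(position _).
rewrite path4_partial_edge_distinguishingE.
by rewrite /path4_distinguishing !positionE.
Qed.

Section ThreeMoveWin.

Variables (G : sgraph) (k : nat) (m0 : move G k) (reply : move G k -> move G k).

Definition three_move_strategy : strategy G k :=
  fun h => if h is [:: _; m1] then reply m1 else m0.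

(** By the length of the history: at lengths 0 and 2 the prescribed move is legal, so the game is
    not over; at length 1 Player 2 can still move; at length 3 Player 1 has just moved; a fourth
    move would contradict the end of the game. *)
Lemma three_move_winning_strategy :
  legal (position [::]) m0 ->
  (exists m1, legal (position [:: m0]) m1) ->
  (forall m1, legal (position [:: m0]) m1 ->
     legal (position [:: m0; m1]) (reply m1) /\
     game_over [:: m0; m1; reply m1]) ->
  winning_strategy Player1 three_move_strategy.
Proof.
move=> leg0 ex1 leg2 [|m [|m1 [|m2 [|m3 h]]]] lh fh.
- by split=> [//|/(_ m0)]; rewrite leg0.
- have -> : m = m0 by apply: (fh [::] m [::]).
  by split=> [//|over]; have [m1] := ex1; rewrite (negbTE (over m1)).
- have Em : m = m0 by apply: (fh [::] m [:: m1]).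
  rewrite Em in lh *.
  have [leg _] := leg2 m1 (lh [:: m0] m1 [::] erefl).
  by split=> [//|/(_ (reply m1))]; rewrite leg.
- by split=> [//|_]; exists [:: m; m1], m2.
- have Em : m = m0 by apply: (fh [::] m [:: m1, m2, m3 & h]).
  have Em2 : m2 = reply m1 by apply: (fh [:: m; m1] m2 (m3 :: h)).
  rewrite Em Em2 in lh.
  have [_ over] := leg2 m1 (lh [:: m0] m1 [:: reply m1, m3 & h] erefl).
  have := lh [:: m0; m1; reply m1] m3 h erefl.
  by rewrite (negbTE (over m3)).
Qed.

End ThreeMoveWin.

Lemma lambda_path4 : lambda (path_graph 4) = 2.
Proof.
rewrite /lambda; case: ex_minnP => k /andP[k_gt0 /existsP[c]].
rewrite -partial_edge_distinguishing_total path4_partial_edge_distinguishingE.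
rewrite /path4_distinguishing !ffunE => /and3P[cP _ _] k_min; apply/eqP; rewrite eqn_leq.
apply/andP; split.
  apply: k_min; rewrite /has_edge_distinguishing /=; apply/existsP.
  (* The coloring [aabb]: its edges receive the three multisets aa, ab and bb. *)
  exists [ffun v : 'I_4 => if v < 2 then ord0 else ord_max].
  rewrite -partial_edge_distinguishing_total path4_partial_edge_distinguishingE.
  by rewrite /path4_distinguishing !ffunE.
(* With a single color the first two edges already agree, against [cP]. *)
case: k k_gt0 c cP {k_min} => [//|[|//]] _ c.
by rewrite (ord1 (c 'v_0)) (ord1 (c 'v_1)) (ord1 (c 'v_2)).
Qed.

(** Replies to ['v_1] or ['v_3] give both vertices one color; the reply to ['v_2] gives ['v_3] the
    other color, [rev_ord] being the swap of the two colors. As ['v_0] is already taken, the default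
    case stands for ['v_3]. *)
Definition path4_reply (m : move (path_graph 4) 2) : move (path_graph 4) 2 :=
  match val m.1 with
  | 1 => ('v_3, m.2)
  | 2 => ('v_3, rev_ord m.2)
  | _ => ('v_1, m.2)
  end.

Theorem theorem3p9 : EDGe_has_winning_strategy (path_graph 4) Player1.
Proof.
rewrite /EDGe_has_winning_strategy lambda_path4.
pose m0 : move (path_graph 4) 2 := ('v_0, ord0).
exists (three_move_strategy m0 path4_reply).
apply: three_move_winning_strategy.
- by rewrite path4_legalE.
- by exists ('v_1, ord0); rewrite path4_legalE.
- move=> m1; rewrite /game_over !path4_legalE => leg1; split.
    move: leg1.
    by case: m1 => [[[|[|[|[|?]]]] ?] [[|[|?]] ?]].
  (* As a Boolean implication, the illegality of every fourth move [m3] is evaluated for each pair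
     of explicit moves [m1] and [m3]. *)
  move=> m3; rewrite path4_legalE; move: leg1; apply/implyP.
  by case: m1 => [[[|[|[|[|?]]]] ?] [[|[|?]] ?]];
     case: m3 => [[[|[|[|[|?]]]] ?] [[|[|?]] ?]]; vm_compute.
Qed.
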